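(* Let $\mathbf L=(L,\vee,\wedge)$ be a lattice and $a,b\in L$ with $a<b$, and assume that the interval $[a,b]$ is complemented and is a modular sublattice of $\mathbf L$. Let $c\in[a,b]$ and let $A$ be a non-empty subset of $[a,b]$. Then $(c^{ab},\le)$, $(A^{ab},\le)$ and $\big((c^{ab})^{ab},\le\big)$ are antichains.
   Context: Here $[a,b]=\{w\in L\mid a\le w\le b\}$. For $x\in[a,b]$, $x^{ab}:=\{y\in[a,b]\mid x\vee y=b\text{ and }x\wedge y=a\}$; for a subset $A\subseteq[a,b]$, $A^{ab}:=\{y\in[a,b]\mid x\vee y=b\text{ and }x\wedge y=a\text{ for all }x\in A\}$. Saying that $[a,b]$ is complemented means $x^{ab}\neq\emptyset$ for all $x\in[a,b]$. An antichain is a set in which any two distinct elements are incomparable (the empty set counts as an antichain). *)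

(* Defs.v *)
From mathcomp Require Import all_boot all_order interval.
From mathcomp Require Import boolp classical_sets.

Set Implicit Arguments.
Unset Strict Implicit.
Unset Printing Implicit Defensive.

Import Order.TTheory.
Local Open Scope order_scope.
Local Open Scope classical_set_scope.

Definition antichain {d : Order.disp_t} {L : porderType d} (X : set L) : Prop :=
  forall x y : L, X x -> X y -> x != y -> x >< y.

Definition sublattice {d : Order.disp_t} {L : latticeType d} (S : set L)
    : Prop :=
  forall x y : L, S x -> S y -> S (x `|` y)%O /\ S (x `&` y)%O.

Definition modular_sublattice {d : Order.disp_t} {L : latticeType d}
    (S : set L) : Prop :=
  sublattice S /\
  forall x y z : L, S x -> S y -> S z -> x <= z ->
    (x `|` (y `&` z) = (x `|` y) `&` z)%O.

(* x^{ab}, the complements of the element x in [a, b]. *)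
Definition relcompl {d : Order.disp_t} {L : latticeType d} (a b x : L)
    : set L :=
  [set y | y \in `[a, b]%O /\ (x `|` y = b)%O /\ (x `&` y = a)%O].

(* A^{ab} for a subset A; it is all of [a, b] when A is empty. *)
Definition relcompl_set {d : Order.disp_t} {L : latticeType d} (a b : L)
    (A : set L) : set L :=
  [set y | y \in `[a, b]%O /\
           forall x : L, A x -> (x `|` y = b)%O /\ (x `&` y = a)%O].

Definition complemented {d : Order.disp_t} {L : latticeType d} (a b : L)
    : Prop :=
  forall x : L, x \in `[a, b]%O -> relcompl a b x !=set0.

(* Main.v *)
Require Import Defs.
From mathcomp Require Import all_boot all_order interval.
From mathcomp Require Import boolp classical_sets.

(** In a modular lattice two comparable complements [y <= z] of the same element
    [x] coincide: the modular law evaluates [y `|` (x `&` z) = (y `|` x) `&` z]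
    to [y `|` a = b `&` z], that is [y = z]. So the complements of a single
    element form an antichain, and so does any set of them. Each of the three
    sets is of this kind: the common complements of a family are complements of
    any one of its members. For the double complement the family is the set of
    complements of [c], which has a member because the interval is
    complemented. *)

Import Order.TTheory.

Local Open Scope order_scope.
Local Open Scope classical_set_scope.

Section ComplementsInModularInterval.

Context {d : Order.disp_t} {L : latticeType d} {a b : L}.
Hypothesis hmod : modular_sublattice `[a, b].

(** Modularity excludes the pentagon formed by [a], [b], [x] and the chain
    [y < z]. *)
Lemma relcompl_le_eq (x y z : L) : x \in `[a, b]%O ->
  relcompl a b x y -> relcompl a b x z -> y <= z -> y = z.
Proof.
move=> xab [yab [xyb _]] [zab [_ xza]] yz.
have [_ /(_ y x z yab xab zab yz)] := hmod.
rewrite xza [(y `|` x)%O]joinC xyb.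
move: yab zab; rewrite !in_itv /= => /andP[ay _] /andP[_ zb].
by rewrite (join_idPl ay) (meet_idPr zb).
Qed.

Lemma antichain_sub_relcompl (x : L) (X : set L) : x \in `[a, b]%O ->
  X `<=` relcompl a b x -> antichain X.
Proof.
move=> xab sX y z /sX yx /sX zx; apply: contra_neqN => /orP[yz|zy].
  exact: (relcompl_le_eq x).
by rewrite (relcompl_le_eq x z y).
Qed.

Lemma antichain_relcompl_set (A : set L) : A `<=` `[a, b] -> A !=set0 ->
  antichain (relcompl_set a b A).
Proof.
move=> sA [x Ax]; apply: (antichain_sub_relcompl x _ (sA _ Ax)) => y [yab yA].
by split=> //; exact: yA.
Qed.

End ComplementsInModularInterval.

Theorem corollary3p2 (d : Order.disp_t) (L : latticeType d) (a b : L)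
    (hab : a < b)
    (hcompl : complemented a b)
    (hmod : modular_sublattice `[a, b])
    (c : L) (hc : c \in `[a, b]%O)
    (A : set L) (hA : A `<=` `[a, b]) (hA0 : A !=set0) :
  [/\ antichain (relcompl a b c),
      antichain (relcompl_set a b A)
    & antichain (relcompl_set a b (relcompl a b c))].
Proof.
split.
- exact: (antichain_sub_relcompl hmod c).
- exact: (antichain_relcompl_set hmod).
- by apply: (antichain_relcompl_set hmod _ _ (hcompl c hc)) => y [].
Qed.
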